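(* Let $I\subset\mathbb{R}\setminus\{0\}$ be an interval, let $f:I\to\mathbb{R}$ be a function differentiable on the interior $I^{\circ}$ of $I$, and let $a,b\in I$ with $a<b$. If $f'\in L[a,b]$, then for every $\lambda\in[0,1]$ $$(1-\lambda) f\left(\frac{2ab}{a+b}\right)+\lambda\left(\frac{f(a)+f(b)}{2}\right)-\frac{ab}{b-a}\int_a^b\frac{f(x)}{x^2}\,dx$$ $$=\frac{ab(b-a)}{2}\left[\int_0^{1/2}\frac{\lambda-2t}{A_t^2}\,f'\left(\frac{ab}{A_t}\right)dt+\int_{1/2}^1\frac{2-\lambda-2t}{A_t^2}\,f'\left(\frac{ab}{A_t}\right)dt\right],$$ where $A_t=tb+(1-t)a$.
   Context: $I^{\circ}$ denotes the interior of the real interval $I$, and $L[a,b]$ denotes the set of integrable functions on $[a,b]$.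
   Formalization: The formal theorem also assumes that f is continuous on [a,b] (new only at a or b when it is an endpoint of I); without this the identity fails, e.g. I=[1,2], a=1, b=2, f(1)=1, f=0 on (1,2], λ=1. *)

(* Defs.v *)
From mathcomp Require Import all_boot all_order all_algebra.
From mathcomp Require Import all_classical all_reals all_analysis.
Import Order.TTheory GRing.Theory Num.Theory numFieldNormedType.Exports.
Set Implicit Arguments.
Unset Strict Implicit.
Unset Printing Implicit Defensive.
Local Open Scope ring_scope.

Definition A_ {R : realType} (a b t : R) : R := t * b + (1 - t) * a.

(* Main.v *)
(** Put [T t = ab / A_t] and [phi = f \o T]. Then
    [phi' t = - ab (b - a) / A_t^2 * f' (T t)], so both integrals on the
    right-hand side have the form [int (k - 2t) phi' t dt] and are computed by
    parts, while the substitution [x = T t] turns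
    [ab / (b - a) int_a^b f x / x^2 dx] into [int_0^1 phi].

    Since [f'] is only assumed to be Lebesgue integrable, integration by parts
    requires the fundamental theorem of calculus for an everywhere
    differentiable [g] with integrable derivative [h]. If [k >= 0] is integrable
    and [h <= k], the Vitali-Caratheodory theorem gives [u] with
    [int u <= int k + e] which, near each point [x], stays above [k x]; then
    [y |-> int_a^y u + eta y - g y] increases locally to the right, whence
    [g b - g a <= int k]. Apply this to [g x + n x] and [max (h, -n) + n] and
    let [n] tend to infinity; the reverse inequality comes from [- g].
    Finally [phi'] is integrable because [|s - t| <= L |T s - T t|] on [[0, 1]],
    which bounds the push-forward by [T] of Lebesgue measure by [L] times
    Lebesgue measure. *)
Require Import Defs.
From mathcomp Require Import all_boot all_order all_algebra.
From mathcomp Require Import all_classical all_reals all_analysis.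
From mathcomp Require Import measurable_realfun ring lra.
Import Order.TTheory GRing.Theory Num.Theory numFieldNormedType.Exports.
Set Implicit Arguments.
Unset Strict Implicit.
Unset Printing Implicit Defensive.
Local Open Scope classical_set_scope.
Local Open Scope ring_scope.

(** * Integrability of compositions through push-forward measures *)

(** The integral of [|g \o T|] over [D] is that of [|g|] against the push-forward by [T] of [mu]
    restricted to [D], a measure bounded by [L] times [nu]. *)
Lemma integrable_comp_dominated (d d' : measure_display) (X : measurableType d)
    (Y : measurableType d') {R : realType} (mu : {measure set X -> \bar R})
    (nu : {measure set Y -> \bar R}) (T : X -> Y) (g : Y -> R)
    (D : set X) (E : set Y) (L : R) :
  0 <= L -> measurable D -> measurable E -> measurable_fun setT T ->
  (forall B, measurable B -> mu (D `&` T @^-1` B) <= L%:E * nu B)%E ->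
  T @` D `<=` E ->
  nu.-integrable E (EFin \o g) -> mu.-integrable D (EFin \o (g \o T)).
Proof.
move=> L0 mD mE mT domT TDE /integrableP[mg goo].
have mTD : measurable_fun D T by exact: measurable_funTS.
apply/integrableP; split.
  apply/measurable_EFinP; apply: (measurable_comp mE) => //.
  exact/measurable_EFinP.
(* Cutting [|g|] off outside [E] gives a function measurable on the whole space, where the two
   measures are compared. *)
pose h := (fun x => `|(g x)%:E|%E) \_ E.
have mh : measurable_fun setT h.
  apply/(measurable_restrictT _ mE); exact: measurableT_comp.
have h0 x : (0 <= h x)%E by rewrite /h patchE; case: ifP.
apply: (@le_lt_trans _ _ (\int[mrestr mu mD]_x h (T x))%E).
  rewrite (eq_measure_integral (mrestr mu mD)); last first.
    by move=> A mA AD; rewrite /= /mrestr setIidl.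
  rewrite (eq_integral (fun x => h (T x))); last first.
    by move=> x /set_mem Dx; rewrite /h patchE mem_set//; apply: TDE; exists x.
  by apply: ge0_subset_integral => //; exact: measurableT_comp.
rewrite -[X in (X < _)%E](ge0_integral_pushforward mT _ measurableT)//.
apply: (@le_lt_trans _ _ (\int[mscale (NngNum L0) nu]_x h x)%E).
  apply: ge0_le_measure_integral => // S mS.
  by rewrite /= /pushforward /mrestr /mscale/= setIC; exact: domT.
by rewrite ge0_integral_mscale//= lte_mul_pinfty// /h -integral_mkcond.
Qed.

Section expansive.
Context {R : realType}.
Notation mu := (@lebesgue_measure R).

Lemma lebesgue_measure_le_diam (A : set R) (r : R) : measurable A -> 0 <= r ->
  (forall s t, A s -> A t -> s - t <= r) -> (mu A <= r%:E)%E.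
Proof.
move=> mA r0 Ar.
have [->|/set0P[t0 At0]] := eqVneq A set0; first by rewrite measure0 lee_fin.
have lbA : has_lbound A by exists (t0 - r) => t At; have := Ar _ _ At0 At; lra.
apply: (@le_trans _ _ (mu `[inf A, inf A + r]%classic)).
  apply: le_measure; rewrite ?inE//.
  move=> t At /=; rewrite in_itv/= ge_inf//= -lerBlDr lb_le_inf//.
    by exists t.
  by move=> s As; have := Ar _ _ At As; lra.
rewrite lebesgue_measure_itv/= lte_fin ltrDl; case: ifPn => _.
  by rewrite -EFinB lee_fin addrAC subrr add0r.
by rewrite lee_fin.
Qed.

(** The part of [D] that [T] sends into an interval of length [l] has diameter at most [L * l];
    summing over a cover of [B] by intervals gives the bound. *)
Lemma lebesgue_measure_preimage_expansive (T : R -> R) (D B : set R) (L : R) :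
  0 < L -> measurable D -> measurable_fun D T ->
  (forall s t, D s -> D t -> `|s - t| <= L * `|T s - T t|) ->
  measurable B -> (mu (D `&` T @^-1` B) <= L%:E * mu B)%E.
Proof.
move=> L0 mD mT DT mB.
have mpre A : measurable A -> measurable (D `&` T @^-1` A).
  by move=> mA; exact: mT.
have [Boo|] := eqVneq (mu B) +oo%E.
  by rewrite Boo mulry gtr0_sg// mul1e leey.
rewrite -ltey => Bfin.
apply/lee_addgt0Pr => e e0.
(* Lebesgue measure is an infimum over countable covers by half-open intervals. The slack [e / L]
   becomes [e] after multiplication by [L]; finiteness of [mu B] makes the inequality strict. *)
have /ereal_inf_lt[z [/= M [covM1 covM2] sMz zDe]] :
    (mu B < mu B + (e / L)%:E)%E.
  by rewrite lte_spaddre ?lte_fin ?divr_gt0// ge0_fin_numE.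
have mM n : measurable (M n : set (measurableTypeR R)).
  by apply: sub_sigma_algebra; exact: covM1.
apply: (@le_trans _ _
    (L%:E * \sum_(0 <= n <oo) wlength idfun (M n))%E); last first.
  rewrite sMz (@le_trans _ _ (L%:E * (mu B + (e / L)%:E))%E)//.
    by rewrite lee_pmul2l// ltW.
  by rewrite muleDr ?fin_num_adde_defl// -EFinM mulrC divfK ?gt_eqF.
apply: (@le_trans _ _ (\sum_(0 <= n <oo) mu (D `&` T @^-1` (M n)))%E).
  apply: measure_sigma_subadditive => //; first by move=> n; exact: mpre (mM n).
    exact: mpre.
  by move=> x [Dx /covM2[n _ Mn]]; exists n.
rewrite -nneseriesZl; last by move=> n _; exact: wlength_ge0.
apply: lee_nneseries => n _ //.
have /ocitvP [->|[[c d]/= cd ->]] := covM1 n.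
  by rewrite preimage_set0 setI0 measure0 wlength0 mule0.
rewrite wlength_itv_bnd ?(ltW cd)//= -EFinM.
apply: lebesgue_measure_le_diam.
- exact: mpre (measurable_itv _).
- by rewrite mulr_ge0 ?subr_ge0 ?(ltW L0) ?(ltW cd).
move=> s t [Ds]/= + [Dt]/=; rewrite !in_itv/= => /andP[? ?] /andP[? ?].
rewrite (le_trans (ler_norm _))// (le_trans (DT _ _ Ds Dt))// ler_pM2l//.
by rewrite ler_norml; apply/andP; split; lra.
Qed.

Lemma integrable_comp_expansive (T g : R -> R) (D E : set R) (L : R) :
  0 < L -> measurable D -> measurable E -> measurable_fun D T ->
  (forall s t, D s -> D t -> `|s - t| <= L * `|T s - T t|) ->
  T @` D `<=` E ->
  mu.-integrable E (EFin \o g) -> mu.-integrable D (EFin \o (g \o T)).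
Proof.
move=> L0 mD mE mT DT TDE ig.
(* [T] is measurable only on [D], so it is replaced by its extension by zero, which is measurable
   everywhere. *)
have TDT : {in D, T \_ D =1 T} by move=> x xD; rewrite patchE xD.
have mTD : measurable_fun setT (T \_ D) by exact/(measurable_restrictT _ mD).
have comp_patch : mu.-integrable D (EFin \o (g \o (T \_ D))) ->
    mu.-integrable D (EFin \o (g \o T)).
  by apply: eq_integrable => // x xD; rewrite /= TDT.
apply: comp_patch.
apply: (@integrable_comp_dominated _ _ (measurableTypeR R) (measurableTypeR R)
    R mu mu (T \_ D) g D E L) => //; first exact: ltW.
- move=> B mB.
  have -> : D `&` (T \_ D) @^-1` B = D `&` T @^-1` B.
    by apply/seteqP; split=> x [Dx]; rewrite /preimage/= (TDT x (mem_set Dx)).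
  exact: lebesgue_measure_preimage_expansive.
- by move=> _ [x Dx <-]; rewrite (TDT x (mem_set Dx)); apply: TDE; exists x.
Qed.
End expansive.

(** * From local growth to a global inequality *)

Section growth.
Context {R : realType}.
Notation mu := (@lebesgue_measure R).

(** The supremum of the points up to which the inequality holds is itself such a point, and [loc]
    would push it further if it were below [b]. *)
Lemma increment_le_of_right_local (g Phi : R -> R) (a b : R) : a <= b ->
  {within `[a, b], continuous g} ->
  (forall x y, a <= x -> x <= y -> y <= b -> Phi x <= Phi y) ->
  (forall x, a <= x < b ->
    exists2 y, x < y <= b & g y - g x <= Phi y - Phi x) ->
  g b - g a <= Phi b - Phi a.
Proof.
move=> ab cg ndPhi loc.
pose S := [set x | a <= x <= b /\ g x - g a <= Phi x - Phi a].
have Sa : S a by split; rewrite ?lexx//= !subrr.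
have ubS : ubound S b by move=> x [/andP[]].
have hsS : has_sup S by split; [exists a | exists b].
set c := sup S.
have ac : a <= c := ub_le_sup hsS.2 Sa.
have cb : c <= b := ge_sup hsS.1 ubS.
(* [Phi] can only jump upwards, which favours the inequality, so continuity of [g] is enough to
   reach the supremum. *)
have Sc : S c.
  split; first by rewrite ac cb.
  apply/ler_addgt0Pr => e e0.
  have cab : c \in `[a, b] by rewrite in_itv/= ac cb.
  have /subspace_continuousP/(_ c cab) := cg.
  move=> /cvgrPdist_le /(_ e e0).
  rewrite near_withinE => -[d /= d0 dP].
  have [x Sx cdx] := sup_adherent d0 hsS.
  have xc : x <= c by exact: (ub_le_sup hsS.2 Sx).
  have [/andP[ax xb] gx] := Sx.
  have gcx : `|g c - g x| <= e.
    apply: dP; last by rewrite /= in_itv/= ax.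
    by rewrite /ball_/= ger0_norm ?subr_ge0// -/c; move: cdx; rewrite -/c; lra.
  move: gcx; rewrite ler_norml => /andP[_ gcx].
  by have := ndPhi x c ax xc cb; lra.
have [cltb|] := ltP c b; last first.
  by move=> bc; have <- : c = b; [apply/le_anti; rewrite cb bc | have [] := Sc].
have [y /andP[cy yb] gy] : exists2 y, c < y <= b & g y - g c <= Phi y - Phi c.
  by apply: loc; rewrite ac.
have Sy : S y.
  split; first by rewrite yb (le_trans ac)// ltW.
  by have [_] := Sc; lra.
by have := ub_le_sup hsS.2 Sy; rewrite -/c leNgt cy.
Qed.
End growth.

(** * A Vitali-Caratheodory majorant *)

Section majorant.
Context {R : realType}.
Notation mu := (@lebesgue_measure R).

(** Lower semicontinuity appears only through its consequence that [u] stays above [k x] around [x],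
    which comes from the openness of the sets [V n]. As an infinite sum, [u] has extended real
    values. *)
Lemma integrable_semicontinuous_majorant (D : set R) (k : R -> R) (e : R) :
  measurable D -> (mu D < +oo)%E -> (forall x, D x -> 0 <= k x) ->
  mu.-integrable D (EFin \o k) -> 0 < e ->
  exists u : R -> \bar R, [/\ measurable_fun setT u, (forall x, 0 <= u x)%E,
    (forall x, D x -> \forall y \near x, ((k x)%:E <= u y)%E) &
    (\int[mu]_(x in D) u x <= \int[mu]_(x in D) (k x)%:E + e%:E)%E].
Proof.
move=> mD Doo k0 ik e0.
have mk : measurable_fun D k by apply/measurable_EFinP; case/integrableP: ik.
have mD0 : 0 <= fine (mu D) by exact: fine_ge0.
(* Rounding [k] up to a multiple of [del] costs at most [del * mu D <= e / 2]. Adding 1 keeps the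
   denominator positive when [D] is null. *)
pose del := e / 2 / (fine (mu D) + 1).
have del0 : 0 < del by rewrite /del !divr_gt0// ltr_wpDl.
have delD : (del%:E * mu D <= (e / 2)%:E)%E.
  rewrite -[mu D]fineK ?ge0_fin_numE// -EFinM lee_fin /del.
  by rewrite mulrAC ler_pdivrMr ?ltr_wpDl// ler_pM2l ?divr_gt0// lerDl.
(* [u] is the sum of [(n + 1) del] over open sets barely larger than the level
   sets [E n], on which [k <= (n + 1) del <= k + del]. *)
pose E n := D `&` k @^-1` [set` `[n%:R * del, n.+1%:R * del[].
have mE n : measurable (E n) by apply: mk => //; exact: measurable_itv.
have ED n : E n `<=` D by move=> x [].
have Efin n : (mu (E n) < +oo)%E.
  apply: le_lt_trans Doo.
  by apply: le_measure; rewrite ?inE; [exact: mE| |exact: ED].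
have tE : trivIset setT E.
  have lt_index n m x : E n x -> E m x -> (n <= m)%N.
    move=> [_ /=] + [_ /=]; rewrite !in_itv/= => /andP[nx _] /andP[_ xm].
    by have := le_lt_trans nx xm; rewrite ltr_pM2r// ltr_nat ltnS.
  move=> n m _ _ [x [xn xm]]; apply/eqP.
  by rewrite eqn_leq (lt_index _ _ _ xn xm) (lt_index _ _ _ xm xn).
have coverE x : D x -> exists n, E n x.
  move=> Dx; exists (Num.truncn (k x / del)); split => //=.
  rewrite in_itv/= -ler_pdivlMr// -ltr_pdivrMr//.
  by apply: truncn_itv; rewrite divr_ge0 ?k0 ?(ltW del0).
pose c n : R := n.+1%:R * del.
have c0 n : 0 < c n by rewrite /c mulr_gt0.
(* The measure allowed for [V n] outside [E n]: dividing by [c n] offsets the weight, and the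
   factors [2 ^ n.+1] make the total excess at most [e / 2]. *)
have e2 n : 0 < e / 2 / (2 ^ n.+1)%:R / c n.
  by rewrite !divr_gt0// ltr0n expn_gt0.
have /choice[V HV] n := lebesgue_regularity_outer (mE n) (Efin n) (e2 n).
have mV n : measurable (V n) by have [oV _ _] := HV n; exact: open_measurable.
pose u x := (\sum_(0 <= n <oo) (c n)%:E * (\1_(V n) x)%:E)%E.
have term0 n x : (0 <= (c n)%:E * (\1_(V n) x)%:E :> \bar R)%E.
  by rewrite -EFinM lee_fin mulr_ge0// ltW.
have mterm n : measurable_fun setT (fun x => (c n)%:E * (\1_(V n) x)%:E)%E.
  by apply: measurable_funeM; apply/measurable_EFinP; exact: measurable_indic.
have mInd n : measurable_fun D (EFin \o \1_(V n) : R -> \bar R).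
  by apply/measurable_EFinP; exact: measurable_indic.
exists u; split.
- exact: ge0_emeasurable_sum.
- by move=> x; exact: nneseries_ge0.
- move=> x /coverE[n En]; have [oV EV _] := HV n.
  have Vx : V n x by exact: EV.
  have : nbhs x (V n) by exact: open_nbhs_nbhs.
  apply: filterS => y Vy.
  apply: le_trans (nneseries_lim_ge n.+1 _) => //.
  rewrite big_nat_recr//=.
  apply: (@le_trans _ _ ((c n)%:E * (\1_(V n) y)%:E)%E).
    rewrite indicE mem_set// mule1 lee_fin.
    by case: En => _ /=; rewrite in_itv/= => /andP[_ /ltW].
  by rewrite leeDr// sume_ge0.
rewrite integral_nneseries//; last first.
  by move=> n; exact: (measurable_funTS (mterm n)).
apply: (@le_trans _ _ (\sum_(0 <= n <oo)
    ((c n)%:E * mu (E n) + (e / 2 / (2 ^ n.+1)%:R)%:E))%E).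
  apply: lee_nneseries => [n _ _|n _].
    by apply: integral_ge0 => x _; exact: term0.
  rewrite ge0_integralZl_EFin ?(ltW (c0 n))//; last first.
    exact: mInd.
  rewrite (integral_indic mu mD (mV n)).
  have [oV EV VE] := HV n.
  apply: (@le_trans _ _ ((c n)%:E * (mu (E n) + mu (V n `\` E n)))%E).
    rewrite lee_pmul2l ?lte_fin ?c0//.
    have mVE : measurable (V n `\` E n) by exact: (measurableD (mV n) (mE n)).
    apply: le_trans (measureU2 mu (mE n) mVE).
    apply: le_measure; rewrite ?inE; [exact: (measurableI _ _ (mV n) mD)| |].
      exact: (measurableU _ _ (mE n) mVE).
    by move=> x [Vx Dx]; have [Ex|Ex] := pselect (E n x); [left|right].
    rewrite ge0_muleDr// leeD2l//.
  apply: (@le_trans _ _ ((c n)%:E * (e / 2 / (2 ^ n.+1)%:R / c n)%:E)%E).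
    by rewrite lee_pmul2l ?lte_fin ?c0// ltW.
  by rewrite -EFinM lee_fin mulrC divfK// gt_eqF.
apply: le_trans (epsilon_trick _ _ _) _.
- by move=> n; rewrite mule_ge0// lee_fin ltW.
- by rewrite divr_ge0// ltW.
rewrite {2}(splitr e) EFinD addeA leeD2r//.
(* On [E n] one has [c n = n del + del <= k + del], so the main sum is at most the integral of
   [k + del] over the disjoint union of the [E n]. *)
apply: (@le_trans _ _ (\int[mu]_(x in D) ((k x)%:E + (cst del%:E) x))%E).
  have DE : D = \bigcup_n E n.
    by apply/seteqP; split=> [x /coverE[n]|x [n _ []]//]; exists n.
  rewrite [X in (_ <= \int[mu]_(x in X) _)%E]DE.
  have mkd : measurable_fun D (fun x => (k x)%:E + cst del%:E x)%E.
    by apply: emeasurable_funD => //; exact/measurable_EFinP.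
  have kd0 x : D x -> (0 <= (k x)%:E + cst del%:E x)%E.
    by move=> Dx; rewrite /= -EFinD lee_fin addr_ge0 ?k0// ltW.
  rewrite ge0_integral_bigcup//; [|by rewrite -DE|by rewrite -DE].
  apply: lee_nneseries => [n _ _|n _]; first by rewrite mule_ge0// lee_fin ltW.
  rewrite -integral_cst//; last exact: mE.
  apply: ge0_le_integral => //.
  - exact: mE.
  - by move=> x _; rewrite /= lee_fin ltW.
  - exact: (measurable_funS mD (ED n) mkd).
  move=> x [_ /=]; rewrite in_itv/= => /andP[nk _].
  by rewrite /= -EFinD lee_fin /c -natr1 mulrDl mul1r lerD2r.
rewrite (@ge0_integralD _ _ _ mu _ mD (EFin \o k) (cst del%:E)); first last.
- exact: measurable_cst.
- by move=> x Dx; rewrite /= lee_fin ltW.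
- exact/measurable_EFinP.
- by move=> x Dx; rewrite /= lee_fin k0.
by rewrite integral_cst// leeD2l.
Qed.
End majorant.

(** * The fundamental theorem of calculus for integrable derivatives *)

Section ftc.
Context {R : realType}.
Notation mu := (@lebesgue_measure R).

Lemma increment_le_integral_ge0 (g k : R -> R) (a b : R) : a < b ->
  {within `[a, b], continuous g} ->
  (forall x, a < x < b -> derivable g x 1) ->
  (forall x, a < x < b -> g^`()%classic x <= k x) ->
  (forall x, a <= x <= b -> 0 <= k x) ->
  mu.-integrable `[a, b] (EFin \o k) ->
  ((g b - g a)%:E <= \int[mu]_(x in `[a, b]) (k x)%:E)%E.
Proof.
move=> ab cg dg gk k0 ik; apply/lee_addgt0Pr => e e0.
have finab : (mu `[a, b]%classic < +oo)%E.
  by rewrite lebesgue_measure_itv/= lte_fin ab -EFinB ltry.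
have e20 : 0 < e / 2 by rewrite divr_gt0.
have [|u [mu' u0 uk intu]] :=
  @integrable_semicontinuous_majorant R `[a, b]%classic k (e / 2)
    (measurable_itv _) finab _ ik e20.
  by move=> x /=; rewrite in_itv/=; exact: k0.
(* The error [e] is shared out: [e / 2] for the majorant [u], [e / 4] for the slope [eta] over the
   interval, [e / 4] for moving the left endpoint. *)
pose eta := e / 4 / (b - a).
have eta0 : 0 < eta by rewrite /eta !divr_gt0// subr_gt0.
pose J x := (\int[mu]_(t in `[a, x]) u t)%E.
have J0 x : (0 <= J x)%E by exact: integral_ge0.
have mJ (i : interval R) : measurable_fun [set` i] u by exact: measurable_funTS.
have Jsplit x y : a <= x -> x <= y ->
    (J y = J x + \int[mu]_(t in `]x, y]) u t)%E.
  move=> ax xy; rewrite /J (@itv_bndbnd_setU _ _ _ (BRight x)) ?bnd_simp//.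
  rewrite ge0_integral_setU//.
  - exact: measurable_funTS.
  - apply/disj_setPS => t [] /=; rewrite !in_itv/= => /andP[_ tx] /andP[xt _].
    by have := le_lt_trans tx xt; rewrite ltxx.
have kfin : (\int[mu]_(x in `[a, b]) (k x)%:E \is a fin_num)%E.
  exact: integrable_fin_num.
have Jfin x : a <= x -> x <= b -> (J x \is a fin_num)%E.
  move=> ax xb; rewrite ge0_fin_numE//.
  apply: (@le_lt_trans _ _ (J b)).
    by rewrite (Jsplit x b)// leeDl// integral_ge0.
  by rewrite (le_lt_trans intu)// ltey_eq fin_numD kfin.
pose Phi x := fine (J x) + eta * x.
(* The derivative is controlled only inside the interval, so the growth argument starts at some [a']
   beyond [a]; continuity of [g] at [a] then brings [a'] back to [a]. *)
have incr a' : a < a' -> a' < b -> g b - g a' <= Phi b - Phi a'.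
  move=> aa' a'b; apply: increment_le_of_right_local; first exact: ltW.
  - apply: continuous_subspaceW cg; apply: subset_itvr.
    by rewrite bnd_simp ltW.
  - move=> x y a'x xy yb; apply: lerD; last by rewrite ler_pM2l.
    have ax : a <= x by rewrite (le_trans _ a'x)// ltW.
    rewrite fine_le ?Jfin ?(le_trans xy)// ?(le_trans ax)//.
    by rewrite (Jsplit x y)// leeDl// integral_ge0.
  move=> x /andP[a'x xb].
  have ax : a < x by rewrite (lt_le_trans aa').
  have axb : a < x < b by rewrite ax.
  have := uk x; rewrite /= in_itv/= !ltW// => /(_ isT) ukx.
  (* Caratheodory's form of the derivative: [g y - g x = q y * (y - x)] with [q] continuous at [x],
     so [q < k x + eta] nearby. *)
  have /is_derive1_caratheodory[q [gq cq qx]] :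
      is_derive x 1 g (g^`()%classic x).
    by rewrite derive1E; exact/derivableP/dg.
  have : \forall y \near x, q y < k x + eta.
    have lt_q : q x < k x + eta by rewrite qx ltr_pwDr// gk.
    exact: (cvgr_lt _ cq).
  move=> /(filterI ukx)[/= d d0 dP].
  (* Halving [d] keeps the segment from [x] to [y] inside the ball where both local bounds hold. *)
  pose y := Order.min (x + d / 2) b.
  have xy : x < y by rewrite lt_min xb ltrDl divr_gt0.
  have yb : y <= b by rewrite ge_min lexx orbT.
  have yd : y <= x + d / 2 by rewrite ge_min lexx.
  have inball t : x <= t -> t <= y -> ball x d t.
    by move=> xt ty; rewrite /ball/= distrC ger0_norm ?subr_ge0//; lra.
  exists y; first by rewrite xy.
  have kint : ((k x * (y - x))%:E <= \int[mu]_(t in `]x, y]) u t)%E.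
    have -> : ((k x * (y - x))%:E = \int[mu]_(t in `]x, y]) cst (k x)%:E t)%E.
      rewrite integral_cst//= lebesgue_measure_itv/= lte_fin xy.
      by rewrite -EFinB -EFinM.
    apply: ge0_le_integral => //.
    - by move=> t _; rewrite /= lee_fin k0// !ltW.
    - exact: mJ.
    - move=> t; rewrite /= in_itv/= => /andP[xt ty].
      by have [] := dP t (inball t (ltW xt) ty).
  have qy : q y < k x + eta by have [] := dP y (inball y (ltW xy) (lexx y)).
  have axy : a <= y by rewrite (le_trans (ltW ax))// ltW.
  have Kfin : (\int[mu]_(t in `]x, y]) u t \is a fin_num)%E.
    by have := Jfin y axy yb; rewrite (Jsplit x y) ?ltW// fin_numD => /andP[].
  have kK : k x * (y - x) <= fine (\int[mu]_(t in `]x, y]) u t)%E.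
    by rewrite -lee_fin fineK.
  have qK : q y * (y - x) <= (k x + eta) * (y - x).
    by rewrite ler_wpM2r ?subr_ge0// ltW.
  rewrite gq /Phi (Jsplit x y (ltW ax) (ltW xy)).
  rewrite fineD// ?Jfin ?(ltW ax) ?(ltW xb)//.
  by move: kK qK; lra.
have [_ ga _] := (continuous_within_itvP g ab).1 cg.
have e40 : 0 < e / 4 by rewrite divr_gt0.
have [a' [[aa' a'b] gaa']] :
    exists a', (a < a' /\ a' < b) /\ `|g a - g a'| <= e / 4.
  apply: (@filter_ex _ a^'+); near=> x; split; first by split.
  by near: x; move/cvgrPdist_le : ga; exact.
have := incr a' aa' a'b.
have Jb : fine (J b) <= fine (\int[mu]_(x in `[a, b]) (k x)%:E)%E + e / 2.
  by rewrite -lee_fin EFinD !fineK// Jfin// ltW.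
have Ja' : 0 <= fine (J a') by exact: fine_ge0.
have etaE : eta * (b - a') <= e / 4.
  by rewrite /eta mulrAC ler_pdivrMr ?subr_gt0// ler_pM2l// lerD2l lerN2 ltW.
rewrite -[X in (_ <= X + _)%E]fineK// -EFinD lee_fin /Phi.
move: gaa'; rewrite ler_norml => /andP[].
by move: Jb Ja' etaE; lra.
Unshelve. all: by end_near. Qed.
End ftc.

Section ftc_eq.
Context {R : realType}.
Notation mu := (@lebesgue_measure R).

(** The truncations [hn n] are bounded by [|h|] in absolute value and agree with [h] eventually at
    each point, so dominated convergence passes to the limit. *)
Lemma increment_le_integral (g h : R -> R) (a b : R) : a < b ->
  {within `[a, b], continuous g} ->
  (forall x, a < x < b -> is_derive x 1 g (h x)) ->
  mu.-integrable `[a, b] (EFin \o h) ->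
  g b - g a <= \int[mu]_(x in `[a, b]) h x.
Proof.
move=> ab cg dg ih.
have mh : measurable_fun `[a, b] h.
  by apply/measurable_EFinP; case/integrableP: ih.
have muab : mu `[a, b]%classic = (b - a)%:E.
  by rewrite lebesgue_measure_itv/= lte_fin ab -EFinB.
pose hn (n : nat) x := Num.max (h x) (- n%:R).
have mhn n : measurable_fun `[a, b] (hn n).
  by apply: (@measurable_maxr _ _ R _ h (cst (- n%:R))) => //.
have mEhn n : measurable_fun `[a, b] (EFin \o hn n).
  by apply/measurable_EFinP; exact: mhn.
have hnh n x : `|hn n x| <= `|h x|.
  rewrite /hn; have [h_lt|//] := ltP (h x) (- n%:R).
  have n0 : 0 <= n%:R :> R by [].
  by rewrite normrN ger0_norm// ltr0_norm; lra.
have ihn n : mu.-integrable `[a, b] (EFin \o hn n).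
  apply: (le_integrable _ _ _ ih) => //; first exact: mEhn.
  by move=> x _; rewrite /= lee_fin hnh.
have icst (c : R) : mu.-integrable `[a, b] (EFin \o cst c).
  apply: continuous_compact_integrable; first exact: segment_compact.
  by apply: continuous_subspaceT => x; exact: cvg_cst.
have key n : ((g b - g a)%:E <= \int[mu]_(x in `[a, b]) (hn n x)%:E)%E.
  pose gn x := g x + n%:R * x.
  have dgn x : a < x < b -> is_derive x 1 gn (h x + n%:R).
    move=> /dg dgx; rewrite /gn.
    by apply: is_derive_eq; rewrite /GRing.scale/= mulr1.
  have := @increment_le_integral_ge0 R gn (fun x => hn n x + n%:R) a b ab.
  have cgn : {within `[a, b], continuous gn}.
    have cn : {within `[a, b], continuous (fun x => n%:R * x)}.
      by apply: continuous_subspaceT => x; exact: mulrl_continuous.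
    by move=> x; exact: cvgD (cg x) (cn x).
  move=> /(_ cgn) H.
  have {H} : ((gn b - gn a)%:E <= \int[mu]_(x in `[a, b]) (hn n x + n%:R)%:E)%E.
    apply: H.
    - by move=> x /dgn[].
    - move=> x /dgn dx; rewrite derive1E derive_val lerD2r.
      by rewrite le_max lexx.
    - by move=> x _; rewrite -lerBlDr sub0r le_max lexx orbT.
    - exact: (integrableD _ (ihn n) (icst n%:R)).
  have intn : (\int[mu]_(x in `[a, b]) (n%:R)%:E = (n%:R * (b - a))%:E)%E.
    by rewrite EFinM -muab -integral_cst.
  (* The shift contributes [n (b - a)] to both sides and cancels. *)
  rewrite (integralD_EFin _ (ihn n) (icst n%:R))//= intn.
  have fhn : (\int[mu]_(x in `[a, b]) (hn n x)%:E \is a fin_num)%E.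
    exact: (integrable_fin_num _ (ihn n)).
  rewrite -[X in (_ <= X + _)%E -> _](fineK fhn).
  rewrite -[X in _ -> (_ <= X)%E](fineK fhn).
  by rewrite -EFinD !lee_fin /gn; lra.
have [] := @dominated_convergence _ _ _ mu _ (measurable_itv `[a, b])
  (fun n => EFin \o hn n) (EFin \o h) (abse \o (EFin \o h)).
- exact: mEhn.
- exact/measurable_EFinP.
- apply: aeW => x _.
  apply: cvg_near_cst; exists (Num.truncn `|h x|).+1 => // m /= xm.
  congr (_%:E).
  rewrite /hn max_l// lerNl (le_trans (ler_norm _))// normrN.
  rewrite (le_trans (ltW (truncnS_gt _)))// ler_nat//.
- exact: integrable_abse.
- by apply: aeW => x m _; rewrite /= lee_fin hnh.
move=> _ _ cvgh.
have fh : (\int[mu]_(x in `[a, b]) (h x)%:E \is a fin_num)%E.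
  exact: (integrable_fin_num _ ih).
rewrite -lee_fin (fineK fh).
rewrite -(cvg_lim _ cvgh)//; apply: lime_ge.
  by apply/cvg_ex; eexists; exact: cvgh.
by apply: nearW => n; exact: key.
Qed.

Lemma integral_is_derive (g h : R -> R) (a b : R) : a < b ->
  {within `[a, b], continuous g} ->
  (forall x, a < x < b -> is_derive x 1 g (h x)) ->
  mu.-integrable `[a, b] (EFin \o h) ->
  \int[mu]_(x in `[a, b]) h x = g b - g a.
Proof.
move=> ab cg dg ih; apply/le_anti; rewrite increment_le_integral// andbT.
have := @increment_le_integral (- g) (- h) a b ab.
have -> : \int[mu]_(x in `[a, b]) (- h) x = - \int[mu]_(x in `[a, b]) h x.
  rewrite -[RHS]mulN1r -(@RintegralZl _ _ R mu _ h (-1) (measurable_itv _) ih).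
  by apply: eq_Rintegral => x _; rewrite mulN1r.
move=> H; rewrite -lerN2 opprB addrC.
have : - g b - - g a <= - \int[mu]_(x in `[a, b]) h x; last first.
  by rewrite opprK addrC.
apply: H.
- by move=> x; apply: cvgN; exact: cg.
- by move=> x /dg dgx; exact: is_deriveN.
- exact: (integrableN ih).
Qed.
End ftc_eq.

(** * Integration by parts against an affine weight *)

Section parts.
Context {R : realType}.
Notation mu := (@lebesgue_measure R).

Lemma integrableMl_within_continuous (h g : R -> R) (c d : R) :
  {within `[c, d], continuous h} -> mu.-integrable `[c, d] (EFin \o g) ->
  mu.-integrable `[c, d] (EFin \o (fun x => h x * g x)).
Proof.
move=> ch ig.
have mh : measurable_fun `[c, d] h by exact: subspace_continuous_measurable_fun.
have bh : [bounded h x | x in `[c, d]%classic].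
  have := compact_bounded (continuous_compact ch (@segment_compact _ c d)).
  move=> [M [Mr HM]]; exists M; split=> // N MN x cdx.
  by apply: HM MN _ _; exists x.
exact: (@integrableMr _ _ R mu _ (measurable_itv _) h (EFin \o g) mh bh ig).
Qed.

(** The product [(k - 2t) phi] has derivative [(k - 2t) dphi - 2 phi], to which [integral_is_derive]
    applies. *)
Lemma integral_affine_is_derive (phi dphi : R -> R) (k c d : R) : c < d ->
  {within `[c, d], continuous phi} ->
  (forall t, c < t < d -> is_derive t 1 phi (dphi t)) ->
  mu.-integrable `[c, d] (EFin \o dphi) ->
  \int[mu]_(t in `[c, d]) ((k - 2 * t) * dphi t) =
  (k - 2 * d) * phi d - (k - 2 * c) * phi c + 2 * \int[mu]_(t in `[c, d]) phi t.
Proof.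
move=> cd cphi dphiE idphi.
have caff : {within `[c, d], continuous (fun t => k - 2 * t)}.
  apply: continuous_subspaceT => t; apply: cvgB; first exact: cvg_cst.
  exact: mulrl_continuous.
have iphi : mu.-integrable `[c, d] (EFin \o phi).
  by apply: continuous_compact_integrable => //; exact: segment_compact.
have i2phi : mu.-integrable `[c, d] (EFin \o (fun t => 2 * phi t)).
  apply: integrableMl_within_continuous => //.
  by apply: continuous_subspaceT => t; exact: cvg_cst.
have iaff := integrableMl_within_continuous caff idphi.
have := @integral_is_derive R (fun t => (k - 2 * t) * phi t)
  (fun t => (k - 2 * t) * dphi t - 2 * phi t) c d cd.
rewrite (@RintegralB _ _ R mu _ _ _ (measurable_itv _) iaff i2phi).
rewrite (@RintegralZl _ _ R mu _ _ 2 (measurable_itv _) iphi) => H.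
apply/eqP; rewrite -subr_eq; apply/eqP; apply: H.
- by move=> t; exact: cvgM (caff t) (cphi t).
- move=> t /dphiE dt.
  have -> : (k - 2 * t) * dphi t - 2 * phi t =
      (k - 2 * t) *: dphi t + phi t *: (0 - 2 *: 1).
    by rewrite /GRing.scale/=; ring.
  exact: is_deriveM.
- exact: (@integrableB _ _ R mu _ (measurable_itv _) _ _ iaff i2phi).
Qed.
End parts.

(** * The path of weighted harmonic means *)

Section harmonic_path.
Context {R : realType}.
Notation mu := (@lebesgue_measure R).
Implicit Types a b s t : R.

(** The weighted harmonic mean of [a] and [b]: for nonzero [a], [b], its inverse is
    [t / a + (1 - t) / b]. *)
Definition harmonic_path a b t := a * b / A_ a b t.

(** [a] and [b] may both be negative; multiplying by [a] treats both signs at once, since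
    [a * A_ a b t] is a convex combination of [a * b] and [a ^+ 2]. *)
Lemma mull_A_gt0 a b t : 0 < a * b -> 0 <= t <= 1 -> 0 < a * A_ a b t.
Proof.
move=> ab0 /andP[t0 t1].
have a2 : 0 < a * a.
  rewrite -expr2 exprn_even_gt0//=.
  by apply: contraTneq ab0 => ->; rewrite mul0r ltxx.
have -> : a * A_ a b t = t * (a * b) + (1 - t) * (a * a) by rewrite /A_; ring.
have [->|tn0] := eqVneq t 0; first by rewrite mul0r add0r subr0 mul1r.
have tab : 0 < t * (a * b) by rewrite mulr_gt0// lt0r tn0.
have ta2 : 0 <= (1 - t) * (a * a) by rewrite mulr_ge0 ?subr_ge0// ltW.
by lra.
Qed.

Lemma A_neq0 a b t : 0 < a * b -> 0 <= t <= 1 -> A_ a b t != 0.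
Proof.
by move=> ab0 /(mull_A_gt0 ab0); apply: contraTneq => ->; rewrite mulr0 ltxx.
Qed.

Lemma is_derive_A a b t : is_derive t 1 (A_ a b) (b - a).
Proof.
rewrite /A_; apply: is_derive_eq.
by rewrite /GRing.scale/=; ring.
Qed.

Lemma is_derive_harmonic_path a b t : A_ a b t != 0 ->
  is_derive t 1 (harmonic_path a b) (- (a * b * (b - a)) / A_ a b t ^+ 2).
Proof.
move=> At; have -> : - (a * b * (b - a)) / A_ a b t ^+ 2 =
    (a * b) *: (- A_ a b t ^- 2 *: (b - a)).
  by rewrite /GRing.scale/=; field.
exact: is_deriveZ (is_deriveV At (is_derive_A a b t)).
Qed.

Lemma harmonic_path_sub a b s t : A_ a b s != 0 -> A_ a b t != 0 ->
  harmonic_path a b s - harmonic_path a b t =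
  a * b * (b - a) * (t - s) / (A_ a b s * A_ a b t).
Proof. by rewrite /harmonic_path /A_ => As At; field; rewrite As At. Qed.

Lemma harmonic_path0 a b : a != 0 -> harmonic_path a b 0 = b.
Proof. by move=> a0; rewrite /harmonic_path /A_; field. Qed.

Lemma harmonic_path1 a b : b != 0 -> harmonic_path a b 1 = a.
Proof. by move=> b0; rewrite /harmonic_path /A_; field. Qed.

Lemma harmonic_path_decreasing a b s t : a < b -> 0 < a * b ->
  0 <= s -> s < t -> t <= 1 -> harmonic_path a b t < harmonic_path a b s.
Proof.
move=> ab ab0 s0 st t1.
have s01 : 0 <= s <= 1 by lra.
have t01 : 0 <= t <= 1 by lra.
rewrite -subr_gt0 harmonic_path_sub ?A_neq0//.
have sqA0 : 0 < (a * A_ a b s) * (a * A_ a b t).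
  by rewrite mulr_gt0// mull_A_gt0.
have a2 : 0 <= a ^+ 2 by exact: sqr_ge0.
apply: divr_gt0; first by rewrite (mulr_gt0 (mulr_gt0 ab0 _)) ?subr_gt0.
rewrite ltNge; apply/negP => AA; move: sqA0.
have -> : a * A_ a b s * (a * A_ a b t) = a ^+ 2 * (A_ a b s * A_ a b t).
  by ring.
by rewrite ltNge mulr_ge0_le0.
Qed.

(** By [harmonic_path_sub] the ratio of the two distances is [|A_s A_t| / (a b (b - a))], and each
    factor [|A_r|] is at most [|a| + |b|]. *)
Lemma harmonic_path_expansive a b s t : a < b -> 0 < a * b ->
  0 <= s <= 1 -> 0 <= t <= 1 ->
  `|s - t| <= (`|a| + `|b|) ^+ 2 / (a * b * (b - a)) *
    `|harmonic_path a b s - harmonic_path a b t|.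
Proof.
move=> ab ab0 s01 t01.
have K0 : 0 < a * b * (b - a) by rewrite mulr_gt0 ?subr_gt0.
have leA r : 0 <= r <= 1 -> `|A_ a b r| <= `|a| + `|b|.
  move=> /andP[r0 r1]; rewrite (le_trans (ler_normD _ _))// addrC lerD//.
    by rewrite normrM ger0_norm ?subr_ge0// ler_piMl// lerBlDr lerDl.
  by rewrite normrM ger0_norm// ler_piMl.
have nA r : 0 <= r <= 1 -> 0 < `|A_ a b r|.
  by move=> r01; rewrite normr_gt0 A_neq0.
rewrite harmonic_path_sub ?A_neq0// normf_div normrM (gtr0_norm K0).
rewrite (normrM (A_ a b s)) (distrC t s).
have -> : (`|a| + `|b|) ^+ 2 / (a * b * (b - a)) *
    (a * b * (b - a) * `|s - t| / (`|A_ a b s| * `|A_ a b t|)) =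
    `|s - t| * ((`|a| + `|b|) ^+ 2 / (`|A_ a b s| * `|A_ a b t|)).
  move: (a * b * (b - a)) K0 => K /lt0r_neq0 nK.
  by field; rewrite nK !lt0r_neq0 ?nA.
rewrite ler_peMr// ler_pdivlMr ?mulr_gt0 ?nA// mul1r expr2.
by rewrite ler_pM ?leA.
Qed.
End harmonic_path.

(** * Change of variables along the harmonic path *)

Section harmonic_integral.
Context {R : realType}.
Notation mu := (@lebesgue_measure R).
Variables a b : R.
Hypotheses (ab : a < b) (ab0 : 0 < a * b).
Let T := harmonic_path a b.

Lemma neq0_of_mul_gt0 : (a != 0) * (b != 0).
Proof. by split; apply: contraTneq ab0 => ->; rewrite ?mul0r ?mulr0 ltxx. Qed.
Let a0 := neq0_of_mul_gt0.1.
Let b0 := neq0_of_mul_gt0.2.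

Lemma harmonic_path_neq0 t : 0 <= t <= 1 -> T t != 0.
Proof. by move=> t01; rewrite !mulf_neq0 ?invr_neq0 ?A_neq0. Qed.

Lemma harmonic_path_itv t : 0 <= t <= 1 -> a <= T t <= b.
Proof.
have T_le u v : 0 <= u -> u <= v -> v <= 1 -> T v <= T u.
  move=> u0 + v1; rewrite le_eqVlt => /predU1P[->//|uv].
  by rewrite ltW//; exact: harmonic_path_decreasing.
move=> /andP[t0 t1].
rewrite -{1}(harmonic_path1 a b0) -{2}(harmonic_path0 b a0).
by rewrite !T_le.
Qed.

Lemma harmonic_path_itv_oo t : 0 < t < 1 -> a < T t < b.
Proof.
move=> /andP[t0 t1].
rewrite -{1}(harmonic_path1 a b0) -{2}(harmonic_path0 b a0).
by rewrite !harmonic_path_decreasing// ltW.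
Qed.

(** Written through [T], the derivative inherits continuity from [T], and its factor [T ^ 2] cancels
    the weight [1 / x ^ 2] in the substitution. *)
Lemma derive1_harmonic_path t : A_ a b t != 0 ->
  T^`()%classic t = - (b - a) / (a * b) * (T t * T t).
Proof.
move=> At; have dT := is_derive_harmonic_path At.
rewrite derive1E derive_val /T /harmonic_path.
by field; rewrite a0 b0 At.
Qed.

Lemma continuous_harmonic_path t : 0 <= t <= 1 -> {for t, continuous T}.
Proof.
move=> t01; have dT := is_derive_harmonic_path (A_neq0 ab0 t01).
by apply/differentiable_continuous/derivable1_diffP.
Qed.

Lemma continuous_derive1_harmonic_path t : 0 <= t <= 1 ->
  {for t, continuous T^`()%classic}.
Proof.
move=> t01; have At := A_neq0 ab0 t01.
have cA : A_ a b x @[x --> t] --> A_ a b t.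
  have dA := is_derive_A a b t.
  by apply/differentiable_continuous/derivable1_diffP.
rewrite /prop_for /continuous_at derive1_harmonic_path//.
(* The formula for the derivative requires [A_ a b x != 0], which persists around [t] even when [t]
   is an endpoint of the unit interval. *)
have eqT : {near t,
    (fun x => - (b - a) / (a * b) * (T x * T x)) =1 T^`()%classic}.
  near=> x; apply/esym; apply: derive1_harmonic_path.
  by near: x; exact: cvgr_neq0 cA At.
apply: cvg_trans (near_eq_cvg eqT) _.
have cT := continuous_harmonic_path t01.
by apply: cvgM; [exact: cvg_cst | exact: cvgM].
Unshelve. all: by end_near. Qed.

Lemma within_continuous_comp_harmonic_path (f : R -> R) :
  {within `[a, b], continuous f} -> {within `[0, 1], continuous (f \o T)}.
Proof.
move=> /subspace_continuousP cf; apply/subspace_continuousP => t.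
rewrite /= in_itv/= => t01.
have Tt : T t \in `[a, b] by rewrite in_itv/= harmonic_path_itv.
apply: cvg_comp (cf _ Tt) => Q HQ.
have : nbhs t (T @^-1` [set x | `[a, b]%classic x -> Q x]).
  exact: (continuous_harmonic_path t01 HQ).
apply: filterS => s /= + s01; apply.
by move: s01; rewrite !in_itv/=; exact: harmonic_path_itv.
Qed.

Lemma integral_harmonic_path (f : R -> R) : {within `[a, b], continuous f} ->
  a * b / (b - a) * \int[mu]_(x in `[a, b]) (f x / x ^+ 2) =
  \int[mu]_(t in `[0, 1]) f (T t).
Proof.
move=> cf.
pose G x := f x / x ^+ 2.
have cG : {within `[T 1, T 0], continuous G}.
  rewrite /T (harmonic_path1 a b0) (harmonic_path0 b a0).
  apply/subspace_continuousP => x xab.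
  apply: cvgM; first by move/subspace_continuousP : cf; exact.
  apply: cvg_within_filter; apply: cvgV; last exact: exprn_continuous.
  (* If 0 lay in [[a, b]], then [a <= 0 <= b] and [a * b] could not be positive. *)
  rewrite sqrf_eq0; apply: contraTneq ab0 => x0.
  move: xab; rewrite /= in_itv/= x0 => /andP[a_le0 b_ge0].
  by rewrite -leNgt mulr_le0_ge0.
have := @integration_by_substitution_decreasing R T G 0 1 ler01.
have -> : T 1 = a := harmonic_path1 a b0.
have -> : T 0 = b := harmonic_path0 b a0.
move=> subst.
rewrite [X in _ * X](_ : _ =
    \int[mu]_(t in `[0, 1]) ((b - a) / (a * b) * f (T t))).
  rewrite RintegralZl//; last first.
    apply: continuous_compact_integrable; first exact: segment_compact.
    exact: within_continuous_comp_harmonic_path.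
  have K1 : a * b / (b - a) * ((b - a) / (a * b)) = 1.
    by field; rewrite a0 b0 subr_eq0 gt_eqF.
  by rewrite mulrA K1 mul1r.
rewrite /Rintegral subst; first congr fine.
- apply: eq_integral => t; rewrite inE/= in_itv/= => t01.
  congr (_%:E).
  change (G (T t) * - T^`()%classic t = (b - a) / (a * b) * f (T t)).
  rewrite derive1_harmonic_path ?A_neq0//.
  have := harmonic_path_neq0 t01; move: (T t) => x x0.
  by rewrite /G; field; rewrite a0 b0.
- move=> s t; rewrite !in_itv/= => /andP[_ s1] /andP[t0 _] ts.
  exact: harmonic_path_decreasing.
- move=> t; rewrite in_itv/= => t01.
  by apply: continuous_derive1_harmonic_path; lra.
- apply/cvg_ex; eexists; apply: cvg_at_right_filter.
  by apply: continuous_derive1_harmonic_path; rewrite lexx ler01.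
- apply/cvg_ex; eexists; apply: cvg_at_left_filter.
  by apply: continuous_derive1_harmonic_path; rewrite lexx ler01.
- split.
  + move=> t; rewrite in_itv/= => t01.
    have At : A_ a b t != 0 by apply: A_neq0 => //; lra.
    by have dT := is_derive_harmonic_path At.
  + apply: cvg_at_right_filter; apply: continuous_harmonic_path.
    by rewrite lexx ler01.
  + apply: cvg_at_left_filter; apply: continuous_harmonic_path.
    by rewrite lexx ler01.
- by move: cG; rewrite /T (harmonic_path1 a b0) (harmonic_path0 b a0).
Qed.

Lemma is_derive_comp_harmonic_path (f : R -> R) t : 0 < t < 1 ->
  derivable f (T t) 1 ->
  is_derive t 1 (f \o T)
    (- (a * b * (b - a)) / A_ a b t ^+ 2 * f^`()%classic (T t)).
Proof.
move=> t01 df.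
have At : A_ a b t != 0 by apply: A_neq0 => //; lra.
have dT := is_derive_harmonic_path At.
have dfT : is_derive (T t) 1 f (f^`()%classic (T t)).
  by rewrite derive1E; exact/derivableP.
by rewrite mulrC; exact: is_derive1_comp.
Qed.

Lemma integrable_derive_comp_harmonic_path (g : R -> R) :
  mu.-integrable `[a, b] (EFin \o g) ->
  mu.-integrable `[0, 1]
    (EFin \o (fun t => - (a * b * (b - a)) / A_ a b t ^+ 2 * g (T t))).
Proof.
move=> ig.
have cT : {within `[0, 1], continuous T}.
  apply: (@within_continuous_comp_harmonic_path idfun).
  by apply: continuous_subspaceT => x; exact: cvg_id.
have igT : mu.-integrable `[0, 1] (EFin \o (g \o T)).
  apply: (@integrable_comp_expansive _ T g `[0, 1]%classic `[a, b]%classic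
      ((`|a| + `|b|) ^+ 2 / (a * b * (b - a)))) => //.
  - rewrite divr_gt0 ?(mulr_gt0 ab0) ?subr_gt0// exprn_gt0//.
    by rewrite ltr_wpDl// normr_gt0 b0.
  - exact: subspace_continuous_measurable_fun.
  - by move=> s t /=; rewrite !in_itv/=; exact: harmonic_path_expansive.
  - move=> _ [t + <-]; rewrite /= !in_itv/=; exact: harmonic_path_itv.
apply: integrableMl_within_continuous => //.
(* This equality holds for every [t]: where [A_ a b t] vanishes, its inverse is 0 and both sides are
   0. *)
have -> : (fun t => - (a * b * (b - a)) / A_ a b t ^+ 2) =
    (fun t => - (b - a) / (a * b) * (T t * T t)).
  apply/funext => t; rewrite /T /harmonic_path.
  rewrite -[in LHS]exprVn; move: (A_ a b t)^-1 => x.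
  by field; rewrite a0 b0.
by move=> t; apply: cvgM; [exact: cvg_cst | exact: cvgM (cT t) (cT t)].
Qed.

End harmonic_integral.

(** When [a] or [b] is an endpoint of [I], [f_diff] says nothing there, and [f_cont] excludes a
    jump: for nonzero [lambda], changing [f a] alone would alter only the left-hand side. *)
Theorem lemma1 (R : realType) (I : set R) (f : R -> R) (a b : R)
  (I_itv : is_interval I) (I_not0 : ~ I 0)
  (f_diff : forall x : R, I° x -> derivable f x 1)
  (Ia : I a) (Ib : I b) (ab : a < b)
  (f_cont : {within `[a, b], continuous f})
  (f'_int : lebesgue_measure.-integrable `[a, b] (EFin \o f^`()%classic))
  (lambda : R) (lambda01 : 0 <= lambda <= 1) :
  (1 - lambda) * f (2 * a * b / (a + b)) + lambda * ((f a + f b) / 2)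
    - a * b / (b - a)
      * (\int[lebesgue_measure]_(x in `[a, b]) (f x / x ^+ 2))
  = a * b * (b - a) / 2
    * ((\int[lebesgue_measure]_(t in `[0, 1 / 2])
          ((lambda - 2 * t) / A_ a b t ^+ 2 * f^`()%classic (a * b / A_ a b t)))
      + (\int[lebesgue_measure]_(t in `[1 / 2, 1])
          ((2 - lambda - 2 * t) / A_ a b t ^+ 2
             * f^`()%classic (a * b / A_ a b t)))).
Proof.
have I_sub (x : R) : a <= x <= b -> I x by exact: I_itv.
have ab0 : 0 < a * b.
  (* If [a * b <= 0], then 0 lies between [a] and [b], hence in [I]. *)
  rewrite ltNge; apply/negP => ab_le0; apply: I_not0; apply: I_sub.
  have [a0|a0] := leP a 0; have [b0|b0] := leP 0 b => //.
  - by have := nmulr_rgt0 b (lt_trans ab b0); nra.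
  - by have := lt_trans a0 ab; nra.
  - by nra.
have [a0 b0] := neq0_of_mul_gt0 ab0.
pose T := harmonic_path a b.
pose phi := f \o T.
pose dphi (t : R) := - (a * b * (b - a)) / A_ a b t ^+ 2 * f^`()%classic (T t).
have phiE (t : R) : 0 < t < 1 -> is_derive t 1 phi (dphi t).
  move=> t01; apply: is_derive_comp_harmonic_path => //; apply: f_diff.
  have abI : `[a, b]%classic `<=` I.
    by move=> x /=; rewrite in_itv/=; exact: I_sub.
  apply: (interiorS abI); rewrite interior_itv_bnd /= in_itv/=.
  exact: harmonic_path_itv_oo.
have cphi : {within `[0, 1], continuous phi}.
  exact: within_continuous_comp_harmonic_path.
have idphi : lebesgue_measure.-integrable `[0, 1] (EFin \o dphi).
  exact: integrable_derive_comp_harmonic_path.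
have iphi : lebesgue_measure.-integrable `[0, 1] (EFin \o phi).
  by apply: continuous_compact_integrable => //; exact: segment_compact.
(* Used with [k = lambda] on the first half and [k = 2 - lambda] on the second; the constant in
   front converts the weight into [dphi]. *)
have parts (k c d : R) : 0 <= c -> c < d -> d <= 1 ->
    \int[lebesgue_measure]_(t in `[c, d])
      ((k - 2 * t) / A_ a b t ^+ 2 * f^`()%classic (a * b / A_ a b t)) =
    - (a * b * (b - a))^-1 * ((k - 2 * d) * phi d - (k - 2 * c) * phi c
       + 2 * \int[lebesgue_measure]_(t in `[c, d]) phi t).
  move=> c0 cd d1.
  have sub01 : `[c, d]%classic `<=` `[0, 1]%classic.
    by apply: subset_itvScc; rewrite bnd_simp.
  have cphi' : {within `[c, d], continuous phi}.
    exact: continuous_subspaceW sub01 cphi.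
  have idphi' : lebesgue_measure.-integrable `[c, d] (EFin \o dphi).
    by apply: integrableS idphi.
  rewrite -(@integral_affine_is_derive R phi dphi k c d cd cphi' _ idphi');
    last first.
    by move=> t cdt; apply: phiE; lra.
  have caff : {within `[c, d], continuous (fun t => k - 2 * t)}.
    apply: continuous_subspaceT => t; apply: cvgB; first exact: cvg_cst.
    exact: mulrl_continuous.
  have iaff := integrableMl_within_continuous caff idphi'.
  rewrite -(@RintegralZl _ _ R lebesgue_measure _ _ _ (measurable_itv _) iaff).
  apply: eq_Rintegral => t _; rewrite /dphi /T /harmonic_path.
  by move: (A_ a b t ^+ 2)^-1 => x; field; rewrite a0 b0 subr_eq0 gt_eqF.
rewrite integral_harmonic_path// !parts ?ltr01 ?divr_gt0 ?ler01//; [|lra..].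
have -> : \int[lebesgue_measure]_(t in `[0, 1]) f (harmonic_path a b t) =
    \int[lebesgue_measure]_(t in `[0, 1 / 2]) phi t +
    \int[lebesgue_measure]_(t in `[1 / 2, 1]) phi t.
  have half0 : (BLeft 0 <= BRight (1 / 2 : R))%O by rewrite bnd_simp; lra.
  have half1 : (BRight (1 / 2 : R) <= BRight 1)%O by rewrite bnd_simp; lra.
  (* The difference of integrals lives on the half-open interval from [1 / 2] to 1; adding its left
     endpoint does not change the integral. *)
  have := Rintegral_itvB iphi half0 half1.
  rewrite Rintegral_itv_obnd_cbnd; last first.
    apply: integrableS iphi => //.
    by apply: subset_itvScc; rewrite bnd_simp; lra.
  by move=> /eqP; rewrite subr_eq addrC => /eqP.
have -> : phi 0 = f b by rewrite /phi/= /T harmonic_path0.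
have -> : phi 1 = f a by rewrite /phi/= /T harmonic_path1.
have -> : phi (1 / 2) = f (2 * a * b / (a + b)).
  have half01 : 0 <= (1 / 2 : R) <= 1 by lra.
  have := A_neq0 ab0 half01; rewrite /phi/= /T /harmonic_path.
  have -> : A_ a b (1 / 2) = (a + b) / 2 by rewrite /A_; field.
  rewrite mulf_eq0 negb_or => /andP[ab_neq0 _].
  by congr f; field; rewrite ab_neq0.
(* The boundary terms add up to [-2 (1 - lambda) phi (1/2) - lambda (f a + f b)], and the remaining
   factor is [-1/2]. *)
by field; rewrite a0 b0 subr_eq0 gt_eqF.
Qed.
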